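(* Let $\Sigma\setminus\{P_0\}$ be of class $C^2$, assume $\mathrm{Ker}(-\pi\mathcal I+\mathcal W+\mathcal S)=\{0\}$ in $\mathcal X$, and let $m_0$ be such that for all $m\ge m_0$ the operators $-\pi\mathcal I+\tilde{\mathcal W}_m+\mathcal S_m:\mathcal X\to\mathcal X$ are invertible with inverses uniformly bounded on $\mathcal X$. Denote by $\mathrm{cond}(-\pi\mathcal I+\tilde{\mathcal W}_m+\mathcal S_m)$ the condition number of the operator $-\pi\mathcal I+\tilde{\mathcal W}_m+\mathcal S_m:\mathcal X\to\mathcal X$ and by $\mathrm{cond}(A_m)$ the condition number of the matrix $A_m:\tilde{\mathbb R}^{3(m+2)}\to\tilde{\mathbb R}^{3(m+2)}$ in infinity norm. Then, for any $m\ge m_0$, $$\mathrm{cond}(A_m)\le\mathrm{cond}(-\pi\mathcal I+\tilde{\mathcal W}_m+\mathcal S_m)\le C,$$ where $C>0$ is independent of $m$.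
   Context: Geometry. $D\subset\mathbb R^2$ is a simply connected bounded region whose boundary $\Sigma$ is a simple closed piecewise smooth curve, twice continuously differentiable except for a single corner $P_0$ with interior angle $\phi=(1-\chi)\pi$, $-1<\chi<1$, $\chi\ne0$. $\Sigma$ is split into three arcs: proceeding counterclockwise, $\Sigma_1$ and $\Sigma_2$ are two sufficiently small smooth arcs meeting at $P_0$, so short that they essentially coincide with the tangent segments to $\Sigma$ at $P_0$ ($\max_{(x,y)\in\Sigma_i}|y-y_{t_i}|\le\delta$, $i=1,2$, with $y_{t_i}$ the ordinate of the point of abscissa $x$ on the segment tangent to $\Sigma_i$ at $P_0$ and $\delta$ a very small positive number); $\Sigma_3$ is the remaining arc connecting $\Sigma_1$ and $\Sigma_2$. Each $\Sigma_i$ has a parametrization $\sigma_i=(\xi_i,\eta_i)\in C^2([0,1])$ with $|\sigma_i'|\neq0$ on $[0,1]$; $\sigma_2,\sigma_3$ are oriented counterclockwise and $\sigma_1$ clockwise along $\Sigma$, with $\sigma_1(0)=\sigma_2(0)=P_0$, $\sigma_2(1)=\sigma_3(0)$, $\sigma_1(1)=\sigma_3(1)$. Kernels. Put $\omega_1=-1$, $\omega_2=\omega_3=1$. For $t,s\in[0,1]$, $$K^{i,j}(t,s)=\omega_j\frac{\eta_j'(t)[\xi_i(s)-\xi_j(t)]-\xi_j'(t)[\eta_i(s)-\eta_j(t)]}{[\xi_i(s)-\xi_j(t)]^2+[\eta_i(s)-\eta_j(t)]^2}\quad(i\ne j\text{ or }t\neq s),$$ $$K^{j,j}(t,t)=\frac{\omega_j}2\,\frac{\eta_j'(t)\xi_j''(t)-\xi_j'(t)\eta_j''(t)}{[\xi_j'(t)]^2+[\eta_j'(t)]^2}$$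 (that is, $K^{i,j}(t,s)=|\sigma_j'(t)|\,\partial_{\mathbf n_Q}\log|\sigma_i(s)-Q|$ at $Q=\sigma_j(t)$, $\mathbf n_Q$ the inner normal). Let $$L(t,s)=-\frac{s\sin(\chi\pi)}{s^2+2ts\cos(\chi\pi)+t^2},\qquad M^{i,j}=K^{i,j}-L\ \text{ for }(i,j)\in\{(1,2),(2,1)\}.$$ Standing fact/assumption: $K^{i,j}$ for $(i,j)\notin\{(1,2),(2,1)\}$ and $M^{1,2},M^{2,1}$ are continuous on $[0,1]\times[0,1]$ (extended by continuity where the formulas are undefined). Let $\mathcal K^{i,j},\mathcal L,\mathcal M^{i,j}$ be the corresponding integral operators, e.g. $(\mathcal L\rho)(s)=\int_0^1L(t,s)\rho(t)\,dt$, $\rho\in C([0,1])$. Spaces and operators. $C([0,1])^3$ has norm $\|(f_1,f_2,f_3)\|_\infty=\max_i\|f_i\|_\infty$. $\mathcal X=\{(f_1,f_2,f_3)^T\in C([0,1])^3: f_1(0)=f_2(0)\}$, $\mathcal I$ is the identity. With $\bar\Omega_1(s)=\bar\Omega_2(s)=\pi$ for $0<s\le1$ and $\bar\Omega_1(0)=\bar\Omega_2(0)=(1-\chi)\pi$, $$\mathcal W=\begin{pmatrix}(-\pi+\bar\Omega_1)I&\mathcal L&0\\ \mathcal L&(-\pi+\bar\Omega_2)I&0\\0&0&0\end{pmatrix},\qquad \mathcal S=\begin{pmatrix}\mathcal K^{1,1}&\mathcal M^{1,2}&\mathcal K^{1,3}\\ \mathcal M^{2,1}&\mathcal K^{2,2}&\mathcal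 K^{2,3}\\ \mathcal K^{3,1}&\mathcal K^{3,2}&\mathcal K^{3,3}\end{pmatrix}.$$ Discretization. The Lobatto rule on $[0,1]$ is $\int_0^1f\,dx\approx\sum_{h=0}^{m+1}\lambda_hf(x_h)$ with $x_0=0$, $x_{m+1}=1$, $x_1<\dots<x_m$ the zeros of the degree-$m$ orthogonal polynomial on $[0,1]$ with respect to the weight $v^{1,1}(x)=x(1-x)$, $\lambda_0=\lambda_{m+1}=\frac1{(m+1)(m+2)}$, $\lambda_k=\int_0^1\frac{l_k(x)v^{1,1}(x)}{v^{1,1}(x_k)}dx$ for $1\le k\le m$, $l_k$ the fundamental Lagrange polynomials on $x_1,\dots,x_m$. Define $(\mathcal L_m\rho)(s)=\sum_h\lambda_hL(x_h,s)\rho(x_h)$, and analogously $\mathcal M_m^{i,j}$, $\mathcal K_m^{i,j}$ with kernels $M^{i,j}$, $K^{i,j}$. $\mathcal W_m$ and $\mathcal S_m$ are obtained from $\mathcal W$ and $\mathcal S$ by replacing each $\mathcal L,\mathcal K^{i,j},\mathcal M^{i,j}$ by $\mathcal L_m,\mathcal K_m^{i,j},\mathcal M_m^{i,j}$. For a fixed constant $c>0$ and a fixed arbitrarily small $\epsilon>0$ (and $m$ with $c/m^{2-2\epsilon}\le1$), $$(\tilde{\mathcal W}_m\varrho)(s)=\begin{cases}(\mathcal W_m\varrho)(s),& \frac c{m^{2-2\epsilon}}\le s\le1,\\ \frac{m^{2-2\epsilon}}c\left[s(\mathcal W_m\varrho)\left(\frac c{m^{2-2\epsilon}}\right)+\left(\frac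 c{m^{2-2\epsilon}}-s\right)(\mathcal W\varrho)(0)\right],&0\le s<\frac c{m^{2-2\epsilon}}.\end{cases}$$ Linear system. $\tilde{\mathbb R}^{3(m+2)}$ is the subspace of arrays $(c_{1,0},\dots,c_{1,m+1},c_{2,0},\dots,c_{2,m+1},c_{3,0},\dots,c_{3,m+1})\in\mathbb R^{3(m+2)}$ with $c_{1,0}=c_{2,0}$. $A_m$ is the matrix of the linear system obtained by collocating $(-\pi\mathcal I+\tilde{\mathcal W}_m+\mathcal S_m)\bar\psi_m=\bar g$ at the nodes $x_0,\dots,x_{m+1}$, with unknowns $a_{i,l}=\bar\psi_{m,i}(x_l)$: for $\mathbf a\in\tilde{\mathbb R}^{3(m+2)}$, $(A_m\mathbf a)_{i,l}=\big[(-\pi\mathcal I+\tilde{\mathcal W}_m+\mathcal S_m)f\big]_i(x_l)$ for any $f\in\mathcal X$ with $f_i(x_l)=a_{i,l}$ (the value depends only on the $a_{i,l}$). The condition number of an invertible operator $T$ is $\|T\|\,\|T^{-1}\|$; for $A_m$ the norms are those induced on $\tilde{\mathbb R}^{3(m+2)}$ by the infinity vector norm. *)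

(* Defs.v *)
(* MathComp-Analysis; the real line is an arbitrary R : realType. *)
From HB Require Import structures.
From mathcomp Require Import all_boot all_order all_algebra.
From mathcomp Require Import all_classical all_reals all_analysis.

Set Implicit Arguments.
Unset Strict Implicit.
Unset Printing Implicit Defensive.

Import Order.TTheory GRing.Theory Num.Theory.
Import numFieldNormedType.Exports.

Local Open Scope classical_set_scope.
Local Open Scope ring_scope.

(** * Bounded operators, inverses, condition numbers *)

(* A normed space is given here by a carrier X inside an ambient type V, an
   equality E and a norm N.  E is needed because a function on [0, 1] is
   represented by a function on R whose values off [0, 1] are irrelevant. *)

(* Extended real: an unbounded operator has norm +oo. *)
Definition opnorm (R : realType) (V : Type) (X : set V) (N : V -> R)
    (T : V -> V) : \bar R :=
  ereal_sup [set (N (T f))%:E | f in [set f | X f /\ N f <= 1]].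

Definition invertible_on (V : Type) (X : set V) (E : V -> V -> Prop)
    (T : V -> V) : Prop :=
  set_fun X X T /\
  forall g, X g -> exists f, [/\ X f, E (T f) g &
    forall f', X f' -> E (T f') g -> E f' f].

(* Meaningful only when [invertible_on X E T]. *)
Definition inverse_on (V : pointedType) (X : set V) (E : V -> V -> Prop)
    (T : V -> V) : V -> V :=
  fun g => get [set f | X f /\ E (T f) g].

Definition cond (R : realType) (V : pointedType) (X : set V)
    (E : V -> V -> Prop) (N : V -> R) (T : V -> V) : \bar R :=
  (opnorm X N T * opnorm X N (inverse_on X E T))%E.

(** * Calculus on [0, 1] and plane curves *)

(* Derivative relative to [0, 1], hence one-sided at 0 and at 1. *)
Definition derivable01 (R : realType) (f : R -> R) (t : R) : Prop :=
  cvg ((f y - f t) / (y - t) @[y --> within `[0, 1] t^']).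

Definition derive01 (R : realType) (f : R -> R) (t : R) : R :=
  lim ((f y - f t) / (y - t) @[y --> within `[0, 1] t^']).

Definition C2_01 (R : realType) (f : R -> R) : Prop :=
  [/\ {in `[0, 1], forall t, derivable01 f t},
      {in `[0, 1], forall t, derivable01 (derive01 f) t} &
      {within `[0, 1], continuous (derive01 (derive01 f))}].

(* S is near P an embedded regular arc of class C^2. *)
Definition C2_curve_at (R : realType) (S : set (R * R)) (P : R * R) : Prop :=
  exists (U : set (R * R)) (u v : R -> R),
    [/\ nbhs P U,
        (u 0, v 0) = P,
        forall w, w = u \/ w = v -> {in `]-1, 1[, forall t : R,
          [/\ derivable w t 1, derivable (derive1 w) t 1 &
              {for t, continuous (derive1n 2 w)}]},
        {in `]-1, 1[, forall t, (derive1 u t, derive1 v t) != (0, 0)} &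
        {in `]-1, 1[ &, injective (fun t => (u t, v t))} /\
        S `&` U = [set (u t, v t) | t in `]-1, 1[]].

Definition simply_connected (R : realType) (D : set (R * R)) : Prop :=
  connected D /\
  forall g : R -> R * R,
    {within `[0, 1], continuous g} -> g 0 = g 1 ->
    (forall t : R, t \in `[0, 1] -> D (g t)) ->
    exists H : R * R -> R * R,
      [/\ {within `[0, 1] `*` `[0, 1], continuous H},
          forall r t : R, r \in `[0, 1] -> t \in `[0, 1] -> D (H (r, t)),
          {in `[0, 1], forall t, H (0, t) = g t /\ H (1, t) = g 0} &
          {in `[0, 1], forall r, H (r, 0) = g 0 /\ H (r, 1) = g 0}].

(** * The domain with one corner *)

(* The three arcs are indexed by 'I_3. *)
Definition i1 : 'I_3 := @Ordinal 3 0 isT.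
Definition i2 : 'I_3 := @Ordinal 3 1 isT.
Definition i3 : 'I_3 := @Ordinal 3 2 isT.

(* sigma_1 is oriented clockwise, sigma_2 and sigma_3 counterclockwise. *)
Definition arc_sign (R : realType) (j : 'I_3) : R := if j == i1 then -1 else 1.

Definition Sigma (R : realType) (xi eta : 'I_3 -> R -> R) : set (R * R) :=
  \bigcup_(i : 'I_3) [set (xi i t, eta i t) | t in `[0, 1]].

Definition speed (R : realType) (xi eta : 'I_3 -> R -> R) (i : 'I_3) (t : R)
    : R :=
  Num.sqrt (derive01 (xi i) t ^+ 2 + derive01 (eta i) t ^+ 2).

Record corner_domain (R : realType) (chi delta : R) (D : set (R * R))
    (xi eta : 'I_3 -> R -> R) : Prop := CornerDomain {
  cd_chi : -1 < chi < 1;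
  cd_chi0 : chi != 0;
  cd_open : open D;
  cd_nonempty : D !=set0;
  cd_bounded : bounded_set D;
  cd_simply_connected : simply_connected D;
  cd_boundary : closure D `\` D = Sigma xi eta;
  cd_xi : forall i, C2_01 (xi i);
  cd_eta : forall i, C2_01 (eta i);
  cd_regular : forall i, {in `[0, 1], forall t, speed xi eta i t != 0};
  (* simple closed curve: the arcs are injective and only share endpoints *)
  cd_injective : forall i,
    {in `[0, 1] &, injective (fun t => (xi i t, eta i t))};
  cd_arcs12 : {in `[0, 1] &, forall s t,
    (xi i1 s, eta i1 s) = (xi i2 t, eta i2 t) <-> s = 0 /\ t = 0};
  cd_arcs23 : {in `[0, 1] &, forall s t,
    (xi i2 s, eta i2 s) = (xi i3 t, eta i3 t) <-> s = 1 /\ t = 0};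
  cd_arcs13 : {in `[0, 1] &, forall s t,
    (xi i1 s, eta i1 s) = (xi i3 t, eta i3 t) <-> s = 1 /\ t = 1};
  (* counterclockwise: D lies on the left of the direction
     arc_sign i * sigma_i' *)
  cd_orientation : forall i, {in `]0, 1[, forall t,
    \forall h \near 0^'+,
      D (xi i t - h * (arc_sign R i * derive01 (eta i) t),
         eta i t + h * (arc_sign R i * derive01 (xi i) t))};
  (* interior angle (1 - chi) pi at P_0: the rotation by this angle sends the
     unit tangent of sigma_2 to the unit tangent of sigma_1 *)
  cd_angle :
    let phi := (1 - chi) * pi in
    let p i := derive01 (xi i) 0 / speed xi eta i 0 in
    let q i := derive01 (eta i) 0 / speed xi eta i 0 in
    p i1 = cos phi * p i2 - sin phi * q i2 /\
    q i1 = sin phi * p i2 + cos phi * q i2;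
  (* the arcs 1 and 2 are delta-close, in ordinate, to their tangent at P_0 *)
  cd_delta : 0 < delta;
  cd_near_tangent : forall i, i != i3 -> {in `[0, 1], forall t,
    exists r : R, [/\ 0 <= r, xi i t = xi i 0 + r * derive01 (xi i) 0 &
      `|eta i t - (eta i 0 + r * derive01 (eta i) 0)| <= delta]}
}.

(** * Kernels *)

Definition kernelK (R : realType) (xi eta : 'I_3 -> R -> R) (i j : 'I_3)
    (t s : R) : R :=
  let dxi := derive01 (xi j) t in
  let deta := derive01 (eta j) t in
  if (i == j) && (t == s) then
    arc_sign R j / 2 *
    ((deta * derive01 (derive01 (xi j)) t
      - dxi * derive01 (derive01 (eta j)) t) / (dxi ^+ 2 + deta ^+ 2))
  else
    arc_sign R j *
    ((deta * (xi i s - xi j t) - dxi * (eta i s - eta j t)) /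
     ((xi i s - xi j t) ^+ 2 + (eta i s - eta j t) ^+ 2)).

Definition kernelL (R : realType) (chi : R) (t s : R) : R :=
  - (s * sin (chi * pi)) / (s ^+ 2 + 2 * t * s * cos (chi * pi) + t ^+ 2).

Definition corner_pair (i j : 'I_3) : bool :=
  ((i == i1) && (j == i2)) || ((i == i2) && (j == i1)).

(* M^{i,j} for the two corner pairs, K^{i,j} otherwise *)
Definition kernelKM (R : realType) (chi : R) (xi eta : 'I_3 -> R -> R)
    (i j : 'I_3) (t s : R) : R :=
  kernelK xi eta i j t s - (if corner_pair i j then kernelL chi t s else 0).

(* kap i j is the extension by continuity of kernelKM i j to [0, 1]^2; the
   formula is undefined where sigma_i(s) = sigma_j(t) with i <> j. *)
Definition continuous_extension (R : realType) (chi : R)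
    (xi eta : 'I_3 -> R -> R) (kap : 'I_3 -> 'I_3 -> R -> R -> R) : Prop :=
  forall i j,
    {within `[0, 1] `*` `[0, 1], continuous (fun p : R * R => kap i j p.1 p.2)} /\
    {in `[0, 1] &, forall t s,
      i = j \/ (xi i s, eta i s) <> (xi j t, eta j t) ->
      kap i j t s = kernelKM chi xi eta i j t s}.

(** * Spaces and operators *)

Definition spaceX (R : realType) : set ('I_3 -> R -> R) :=
  [set f : 'I_3 -> R -> R | (forall i, {within `[0, 1], continuous (f i)}) /\
     f i1 0 = f i2 0].

Definition eqX (R : realType) (f g : 'I_3 -> R -> R) : Prop :=
  forall i, {in `[0, 1], f i =1 g i}.

Definition normX (R : realType) (f : 'I_3 -> R -> R) : R :=
  \big[Num.max/0]_(i < 3) sup [set `|f i s| | s in `[0, 1]].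

Definition Omega_bar (R : realType) (chi : R) (s : R) : R :=
  if s == 0 then (1 - chi) * pi else pi.

(* W and W_m, for Lop the operator L, respectively L_m *)
Definition block_W (R : realType) (chi : R) (Lop : (R -> R) -> R -> R)
    (f : 'I_3 -> R -> R) (i : 'I_3) (s : R) : R :=
  if i == i1 then (- pi + Omega_bar chi s) * f i1 s + Lop (f i2) s
  else if i == i2 then Lop (f i1) s + (- pi + Omega_bar chi s) * f i2 s
  else 0.

(* The operator of kernel k : (t, s) |-> k t s *)
Definition int_op (R : realType) (k : R -> R -> R) (rho : R -> R) (s : R) : R :=
  \int[@lebesgue_measure R]_(t in `[0, 1]) (k t s * rho t).

Definition opW (R : realType) (chi : R) (f : 'I_3 -> R -> R) :=
  block_W chi (int_op (kernelL chi)) f.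

Definition opS (R : realType) (kap : 'I_3 -> 'I_3 -> R -> R -> R)
    (f : 'I_3 -> R -> R) (i : 'I_3) (s : R) : R :=
  \sum_j int_op (kap i j) (f j) s.

(** * The Lobatto rule *)

Definition v11 (R : realType) (y : R) : R := y * (1 - y).

Definition interior_node (m : nat) (k : 'I_m.+2) : bool := (0 < k < m.+1)%N.

Definition lobatto_nodes (R : realType) (m : nat) (x : 'I_m.+2 -> R) : Prop :=
  [/\ x ord0 = 0, x ord_max = 1,
      forall j k : 'I_m.+2, interior_node j -> interior_node k -> (j < k)%N ->
        x j < x k &
      exists p : {poly R},
        [/\ size p = m.+1,
            forall q : {poly R}, (size q <= m)%N ->
              \int[@lebesgue_measure R]_(y in `[0, 1])
                (p.[y] * q.[y] * v11 y) = 0 &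
            forall k, interior_node k -> root p (x k)]].

Definition lagrange_fun (R : realType) (m : nat) (x : 'I_m.+2 -> R)
    (k : 'I_m.+2) (y : R) : R :=
  \prod_(j < m.+2 | interior_node j && (j != k)) ((y - x j) / (x k - x j)).

Definition lobatto_weight (R : realType) (m : nat) (x : 'I_m.+2 -> R)
    (k : 'I_m.+2) : R :=
  if interior_node k then
    \int[@lebesgue_measure R]_(y in `[0, 1])
      (lagrange_fun x k y * v11 y / v11 (x k))
  else (m.+1%:R * m.+2%:R)^-1.

(** * The discretized operators *)

Definition quad_op (R : realType) (m : nat) (x : 'I_m.+2 -> R)
    (k : R -> R -> R) (rho : R -> R) (s : R) : R :=
  \sum_(h < m.+2) lobatto_weight x h * k (x h) s * rho (x h).

Definition opWm (R : realType) (chi : R) (m : nat) (x : 'I_m.+2 -> R)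
    (f : 'I_3 -> R -> R) :=
  block_W chi (quad_op x (kernelL chi)) f.

Definition opSm (R : realType) (kap : 'I_3 -> 'I_3 -> R -> R -> R) (m : nat)
    (x : 'I_m.+2 -> R) (f : 'I_3 -> R -> R) (i : 'I_3) (s : R) : R :=
  \sum_j quad_op x (kap i j) (f j) s.

Definition threshold (R : realType) (c eps : R) (m : nat) : R :=
  c / (m%:R `^ (2 - 2 * eps)).

Definition opWtilde (R : realType) (chi c eps : R) (m : nat)
    (x : 'I_m.+2 -> R) (f : 'I_3 -> R -> R) (i : 'I_3) (s : R) : R :=
  let h := threshold c eps m in
  if h <= s then opWm chi x f i s
  else h^-1 * (s * opWm chi x f i h + (h - s) * opW chi f i 0).

Definition opT (R : realType) (chi : R) (kap : 'I_3 -> 'I_3 -> R -> R -> R)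
    (f : 'I_3 -> R -> R) (i : 'I_3) (s : R) : R :=
  - pi * f i s + opW chi f i s + opS kap f i s.

Definition opTm (R : realType) (chi c eps : R)
    (kap : 'I_3 -> 'I_3 -> R -> R -> R) (m : nat) (x : 'I_m.+2 -> R)
    (f : 'I_3 -> R -> R) (i : 'I_3) (s : R) : R :=
  - pi * f i s + opWtilde chi c eps x f i s + opSm kap x f i s.

(** * The linear system *)

(* c_{i,l} is the entry of index mxvec_index i l, that is i * (m + 2) + l *)
Definition Rtilde (R : realType) (m : nat) : set 'cV[R]_(3 * m.+2) :=
  [set a | a (mxvec_index i1 ord0) 0 = a (mxvec_index i2 ord0) 0].

(* A is determined by this on Rtilde, and only its action there matters. *)
Definition collocation_matrix (R : realType) (m : nat) (x : 'I_m.+2 -> R)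
    (T : ('I_3 -> R -> R) -> 'I_3 -> R -> R) (A : 'M[R]_(3 * m.+2)) : Prop :=
  forall a f, Rtilde a -> spaceX f ->
    (forall i l, f i (x l) = a (mxvec_index i l) 0) ->
    forall i l, (A *m a) (mxvec_index i l) 0 = T f i (x l).

Definition condX (R : realType) (T : ('I_3 -> R -> R) -> 'I_3 -> R -> R)
    : \bar R :=
  cond (@spaceX R) (@eqX R) (@normX R) T.

(* The norm of 'cV[R]_n is the maximum of the moduli of the entries. *)
Definition condA (R : realType) (m : nat) (A : 'M[R]_(3 * m.+2)) : \bar R :=
  cond (@Rtilde R m) eq (fun a : 'cV[R]_(3 * m.+2) => `|a|) (mulmx A).

(* Main.v *)
Require Import Defs.
From HB Require Import structures.
From mathcomp Require Import all_boot all_order all_algebra.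
From mathcomp Require Import all_classical all_reals all_analysis.
From mathcomp Require Import ring lra.

Set Implicit Arguments.
Unset Strict Implicit.
Unset Printing Implicit Defensive.

Import Order.TTheory GRing.Theory Num.Theory.
Import numFieldNormedType.Exports.

Local Open Scope classical_set_scope.
Local Open Scope ring_scope.

(** Two things have to be shown: the operators T_m = - pi + W~_m + S_m are
    bounded uniformly in m (their inverses are so by hypothesis), and passing
    from T_m to its collocation matrix A_m does not increase the norm of the
    operator or of its inverse.

    Uniform boundedness reduces to the quadrature sums of the Mellin-type
    kernel L(t, s), which is bounded by a multiple of s / (t + s)^2 and has a peak of width
    s at the corner.  The peak is resolved as long as s is at least c / m^2, and
    this holds above the threshold c / m^(2 - 2 eps).  Instead of using
    asymptotics of the nodes and weights, s / (t + s)^2 is compared with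
    a polynomial: the Chebyshev polynomial of degree m is at least 1 + m^2 y at
    1 + y, so 1 / (t + s) is approximated on [0, 1] by a polynomial Q of degree
    below m with a relative error bounded away from 1 ([resolvent_approx]).
    Then s Q^2 has degree small enough for the Lobatto rule, whose sums over the
    interior nodes do not exceed the integral of a nonnegative polynomial
    ([lobatto_interior_le]), and the integral of s / (t + s)^2 is at most 1.
    This gives [lobatto_resolvent_sum] and then [opTm_bound].  The properties of
    the rule that are needed (interior nodes in ]0, 1[, nonnegative weights)
    follow from Gauss exactness for the weight t (1 - t).

    For the matrix, every vector in the coefficient space is the sample at
    the nodes of a function of X with the same norm ([sample_onto]), and A_m maps
    the sample of f to the sample of T_m f.  Hence the norm of A_m is at most
    that of T_m.  Since T_m + pi depends only on values at the nodes, solutions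
    of the linear system lift to solutions of the operator equation
    ([nystrom_lift]); so A_m is invertible, its inverse is the sampled inverse
    of T_m, and its norm is at most that of the inverse of T_m. *)

(** * Chebyshev polynomials and approximate resolvents *)

Section Chebyshev.
Variable R : realType.

(** The pair (T_n, U_{n-1}) of Chebyshev polynomials of both kinds: it is the
    expansion of (X + sqrt (X^2 - 1))^n in the basis 1, sqrt (X^2 - 1), and the
    recurrence is multiplication by X + sqrt (X^2 - 1).  With this form
    [cheb_pell] is multiplicativity of the norm, and trigonometry is
    avoided. *)
Fixpoint cheb (n : nat) : {poly R} * {poly R} :=
  if n is n'.+1 then
    let: (T, U) := cheb n' in ('X * T + ('X^2 - 1) * U, T + 'X * U)
  else (1, 0).

Lemma chebTS n : (cheb n.+1).1 = 'X * (cheb n).1 + ('X^2 - 1) * (cheb n).2.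
Proof. by rewrite /=; case: (cheb n). Qed.

Lemma chebUS n : (cheb n.+1).2 = (cheb n).1 + 'X * (cheb n).2.
Proof. by rewrite /=; case: (cheb n). Qed.

Lemma cheb_pell n :
  (cheb n).1 ^+ 2 - ('X^2 - 1) * (cheb n).2 ^+ 2 = 1.
Proof.
elim: n => [|n IH]; first by rewrite expr1n expr0n/= mulr0 subr0.
rewrite chebTS chebUS -[RHS]IH; ring.
Qed.

Lemma size_cheb n :
  (size (cheb n).1 <= n.+1)%N /\ (size (cheb n).2 <= n)%N.
Proof.
elim: n => [|n [IH1 IH2]]; first by rewrite /= size_poly1 size_poly0.
have sX (p : {poly R}) : (size ('X * p)%R <= (size p).+1)%N.
  by apply: leq_trans (size_polyMleq _ _) _; rewrite size_polyX.
have sX2 : (size ('X^2 - 1 : {poly R})%R <= 3)%N.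
  by rewrite (leq_trans (size_polyD _ _))// size_polyXn size_polyN size_poly1.
rewrite chebTS chebUS; split.
  apply: leq_trans (size_polyD _ _) _; rewrite geq_max (leq_trans (sX _))//=.
  apply: leq_trans (size_polyMleq _ _) _.
  by rewrite -subn1 leq_subLR add1n (leq_trans (leq_add sX2 IH2)).
apply: leq_trans (size_polyD _ _) _; rewrite geq_max IH1/=.
by rewrite (leq_trans (sX _)).
Qed.

Lemma cheb_le1 n (z : R) : -1 <= z <= 1 -> `|(cheb n).1.[z]| <= 1.
Proof.
move=> z1; have := congr1 (horner^~ z) (cheb_pell n).
rewrite hornerD hornerN !horner_exp [('X^2 - 1) * _]mulrC hornerM hornerD hornerN hornerXn horner_exp !hornerC => pell.
have z2 : 0 <= 1 - z ^+ 2 by nra.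
have U0 := mulr_ge0 (sqr_ge0 (cheb n).2.[z]) z2.
have : (cheb n).1.[z] ^+ 2 <= 1 by lra.
by rewrite -real_normK ?num_real// expr_le1.
Qed.

(** The convexity bound T_n(1 + y) >= 1 + n^2 y, whose slope n^2 = T_n'(1) is
    what matches the threshold of order m^-2; the induction needs the bound on
    U_{n-1} at the same time. *)
Lemma cheb_growth n (y : R) : 0 <= y ->
  1 + n%:R ^+ 2 * y <= (cheb n).1.[1 + y] /\ n%:R <= (cheb n).2.[1 + y].
Proof.
move=> y0; elim: n => [|n [IH1 IH2]].
  by rewrite /= !hornerE; split; lra.
rewrite chebTS chebUS !hornerE -natr1.
have n0 : 0 <= n%:R :> R by [].
split; nra.
Qed.


(** Take r(t) = T_n(1 - 2 t) / T_n(1 + 2 s).  It is small on [0, 1], where the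
    numerator is at most 1, and r(- s) = 1, so that Q = (1 - r) / (X + s) is a
    polynomial approximating 1 / (t + s) with relative error r. *)
Lemma resolvent_approx (n : nat) (s : R) : 0 < s ->
  exists Q : {poly R}, (size Q <= n)%N /\
    forall t, 0 <= t <= 1 ->
      `|1 - Q.[t] * (t + s)| <= (1 + 2 * n%:R ^+ 2 * s)^-1.
Proof.
move=> s0; have [ge_T _] := @cheb_growth n (2 * s) ltac:(by rewrite mulr_ge0// ltW).
set T := (cheb n).1 in ge_T; set a := T.[1 + 2 * s] in ge_T.
have n0 : 0 <= n%:R ^+ 2 :> R by rewrite exprn_ge0.
have a1 : 1 + 2 * n%:R ^+ 2 * s <= a by rewrite (le_trans _ ge_T)//; lra.
have d0 : 0 < 1 + 2 * n%:R ^+ 2 * s by rewrite ltr_wpDr// !mulr_ge0// ltW.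
have a0 : 0 < a by exact: lt_le_trans a1.
have [r [rE sr]] : exists r : {poly R},
    (forall t, r.[t] = a^-1 * T.[1 - 2 * t]) /\ (size r <= n.+1)%N.
  exists (a^-1 *: (T \Po (1 - 2 *: 'X))); split.
    by move=> t; rewrite hornerZ horner_comp !hornerE.
  rewrite (leq_trans (size_scale_leq _ _))//.
  have s2 : (size (1 - 2 *: 'X : {poly R})%R <= 2)%N.
    rewrite (leq_trans (size_polyD _ _))// size_poly1 size_polyN geq_max/=.
    by rewrite (leq_trans (size_scale_leq _ _))// size_polyX.
  rewrite (leq_trans (size_comp_poly_leq _ _))// ltnS.
  have [sT _] := size_cheb n.
  rewrite (@leq_trans ((size T).-1 * 1)%N)//.
    by rewrite leq_mul2l -[X in (X <= _)%N]subn1 leq_subLR s2 orbT.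
  by rewrite muln1 -subn1 leq_subLR add1n.
have /factor_theorem[Q rQ] : root (1 - r) (- s).
  by rewrite rootE hornerD hornerN hornerC rE mulrN opprK mulVf ?subrr// gt_eqF.
exists Q; split.
  have [->|Q0] := eqVneq Q 0; first by rewrite size_poly0.
  have : (size (1 - r)%R <= n.+1)%N.
    by rewrite (leq_trans (size_polyD _ _))// size_poly1 size_polyN geq_max.
  by rewrite rQ size_Mmonic ?monicXsubC// size_XsubC addn2.
move=> t /andP[t0 t1].
have -> : 1 - Q.[t] * (t + s) = r.[t].
  have := congr1 (horner^~ t) rQ.
  rewrite hornerD hornerN hornerC hornerM hornerXsubC opprK => <-; ring.
rewrite rE normrM gtr0_norm ?invr_gt0//.
rewrite (@le_trans _ _ (a^-1 * 1))//.
  rewrite ler_wpM2l// ?invr_ge0 ?(ltW a0)//.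
  by apply: cheb_le1; apply/andP; split; lra.
by rewrite mulr1 lef_pV2.
Qed.

End Chebyshev.

(** * Integrals of polynomials over [0, 1] *)

Section PolyIntegral.
Variable R : realType.
Local Notation mu := (@lebesgue_measure R).

Definition ipoly (p : {poly R}) : R := \int[mu]_(y in `[0, 1]) p.[y].

Lemma continuous_integrable01 (f : R -> R) : {within `[0, 1], continuous f} ->
  mu.-integrable `[0, 1] (EFin \o f).
Proof. by move=> cf; apply: continuous_compact_integrable => //; exact: segment_compact. Qed.

Lemma poly_integrable01 (p : {poly R}) :
  mu.-integrable `[0, 1] (EFin \o horner p).
Proof.
apply: continuous_integrable01; apply: continuous_subspaceT.
exact: continuous_horner.
Qed.

Lemma ipolyD p q : ipoly (p + q) = ipoly p + ipoly q.
Proof.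
rewrite /ipoly -RintegralD ?poly_integrable01//.
by apply: eq_Rintegral => t _; rewrite hornerD.
Qed.

Lemma ipolyZ a p : ipoly (a *: p) = a * ipoly p.
Proof.
rewrite /ipoly -RintegralZl ?poly_integrable01//.
by apply: eq_Rintegral => t _; rewrite hornerZ.
Qed.

Lemma ipoly0 : ipoly 0 = 0.
Proof. by rewrite -(scale0r 0) ipolyZ mul0r. Qed.

Lemma ipolyB p q : ipoly (p - q) = ipoly p - ipoly q.
Proof. by rewrite ipolyD -scaleN1r ipolyZ mulN1r. Qed.

Lemma ipoly_sum (I : Type) (r : seq I) (P : pred I) (F : I -> {poly R}) :
  ipoly (\sum_(i <- r | P i) F i) = \sum_(i <- r | P i) ipoly (F i).
Proof. exact: (big_morph ipoly ipolyD ipoly0). Qed.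

Lemma ipoly_ge0 p : (forall t, 0 <= t <= 1 -> 0 <= p.[t]) -> 0 <= ipoly p.
Proof. by move=> p0; apply: Rintegral_ge0 => t /=; rewrite in_itv/=; exact: p0. Qed.

Lemma ipoly1 : ipoly 1 = 1.
Proof.
rewrite /ipoly (@eq_Rintegral _ _ _ _ _ (cst 1)); last first.
  by move=> t _; rewrite hornerE.
by rewrite Rintegral_cst//= lebesgue_measure_itv/= lte01 oppr0 adde0 mul1r.
Qed.

Lemma finite_roots (p : {poly R}) : p != 0 -> finite_set [set t | root p t].
Proof.
have [n] := ubnP (size p); elim: n p => // n IH p sp p0.
have [[a pa]|nr] := pselect (exists a, root p a); last first.
  rewrite [X in finite_set X](_ : _ = set0)//.
  by apply/seteqP; split => // t /= pt; apply: nr; exists t.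
have /factor_theorem[q pq] := pa.
have q0 : q != 0 by apply: contra_neq p0 => q0; rewrite pq q0 mul0r.
apply: (@sub_finite_set _ _ ([set t | root q t] `|` [set a])).
  by move=> t /=; rewrite pq rootM root_XsubC => /orP[|/eqP]; [left|right].
rewrite finite_setU; split => //; apply: IH => //.
by move: sp; rewrite pq size_Mmonic ?monicXsubC// size_XsubC addn2.
Qed.

(** A nonnegative function of zero integral vanishes almost everywhere, while a
    nonzero polynomial vanishes only on a finite set. *)
Lemma ipoly_eq0 p : (forall t, 0 <= t <= 1 -> 0 <= p.[t]) -> ipoly p = 0 ->
  p = 0.
Proof.
move=> p0 ip0; apply/eqP/negPn/negP => pN0.
have intp := poly_integrable01 p.
case/integrableP: (intp) => mp _.
have : (\int[mu]_(x in `[0%R, 1%R]) `|(EFin \o horner p) x| = 0)%E.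
  under eq_integral => t.
    rewrite inE/= in_itv/= => t01; rewrite ger0_norm ?p0//; over.
  rewrite -[LHS]fineK; last exact: integrable_fin_num.
  by rewrite -/(Rintegral _ _ _) -/(ipoly p) ip0.
move/ae_eq_integral_abs => /(_ (measurable_itv _) mp) [N [mN N0 subN]].
have cr := finite_set_countable (finite_roots pN0).
have mr : measurable ([set t | root p t] : set (measurableTypeR R)).
  exact: countable_measurable.
have : (mu `[0%R, 1%R] <= mu (N `|` [set t | root p t]))%E.
  apply: le_measure; rewrite ?inE//; first exact: measurableU.
  move=> t /= t01; have [pt|pt] := boolP (root p t); [by right|left].
  apply: subN => /= /(_ t01) [] pt0.
  by move: pt; rewrite /root pt0 eqxx.
rewrite measureU0//; last exact: countable_lebesgue_measure0.
rewrite [X in (_ <= X)%E]N0 lebesgue_measure_itv/= lte_fin ltr01 oppr0 adde0.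
by rewrite lee_fin ler10.
Qed.

End PolyIntegral.

(** * Lagrange interpolation *)

Section Lagrange.
Variables (R : fieldType) (I : finType) (S : pred I) (x : I -> R).
Hypothesis injx : {in S &, injective x}.

Definition lagrange_poly (k : I) : {poly R} :=
  \prod_(j | S j && (j != k)) ((x k - x j)^-1 *: ('X - (x j)%:P)).

Lemma lagrange_poly_node k l : S k -> S l ->
  (lagrange_poly k).[x l] = (k == l)%:R.
Proof.
move=> Sk Sl; rewrite horner_prod; have [<-|kl] := eqVneq k l.
  apply: big1 => j /andP[Sj jk]; rewrite hornerZ hornerXsubC mulVf// subr_eq0.
  by apply: contra jk => /eqP /injx ->.
rewrite (bigD1 l) ?Sl 1?eq_sym//= hornerZ hornerXsubC subrr mulr0 mul0r//.
Qed.

Lemma size_lagrange_poly k : S k -> (size (lagrange_poly k) <= #|S|)%N.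
Proof.
move=> Sk; apply: leq_trans (size_poly_prod_leq _ _) _.
set n := #|_|; have <- : n.+1 = #|S|.
  rewrite (cardD1 k) [k \in _]Sk add1n; congr _.+1.
  by apply: eq_card => j; rewrite !inE andbC.
rewrite leq_subLR addnS ltnS addnn -muln2 -sum_nat_const; apply: leq_sum => j _.
by rewrite (leq_trans (size_scale_leq _ _))// size_XsubC.
Qed.

Lemma lagrange_interp (q : {poly R}) : (size q <= #|S|)%N ->
  q = \sum_(k | S k) q.[x k] *: lagrange_poly k.
Proof.
move=> sq; apply/eqP; rewrite -subr_eq0; apply/eqP.
apply: (@roots_geq_poly_eq0 _ _ [seq x k | k <- enum S]).
- apply/allP => _ /mapP[k + ->]; rewrite mem_enum => Sk.
  rewrite rootE hornerD hornerN horner_sum (bigD1 k)//= hornerZ.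
  rewrite lagrange_poly_node// eqxx mulr1 big1 ?addr0 ?subrr// => j /andP[Sj jk].
  by rewrite hornerZ lagrange_poly_node// (negbTE jk) mulr0.
- rewrite map_inj_in_uniq ?enum_uniq// => k l; rewrite !mem_enum; exact: injx.
rewrite size_map -cardE (leq_trans (size_polyD _ _))// geq_max sq size_polyN.
rewrite (leq_trans (size_sum _ _ _))//; apply/bigmax_leqP => k Sk.
by rewrite (leq_trans (size_scale_leq _ _))// size_lagrange_poly.
Qed.

End Lagrange.

(** * The Lobatto rule *)

Section Lobatto.
Variables (R : realType) (m : nat) (x : 'I_m.+2 -> R).
Hypothesis hx : lobatto_nodes x.
Local Notation int := (@interior_node m).
Local Notation lag := (lagrange_poly int x).
Local Notation V := ('X * (1 - 'X) : {poly R}).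

Lemma card_interior : #|[pred k | int k]| = m.
Proof.
have : #|'I_m.+2| = m.+2 by rewrite card_ord.
rewrite (cardD1 ord0) (cardD1 ord_max) !inE/= !add1n => -[] h.
rewrite -[RHS]h; apply: eq_card => k; rewrite !inE andbT /interior_node.
by rewrite -!val_eqE/= lt0n ltn_neqAle -ltnS ltn_ord andbT andbC.
Qed.

Lemma lobatto_interior_inj : {in int &, injective x}.
Proof.
case: hx => _ _ inc _ k l ik il; have [kl|lk|/val_inj//] := ltngtP k l => xkl.
  by have := inc _ _ ik il kl; rewrite xkl ltxx.
by have := inc _ _ il ik lk; rewrite xkl ltxx.
Qed.

Lemma hornerV t : V.[t] = v11 t.
Proof. by rewrite hornerM hornerD hornerN hornerX hornerC. Qed.

Lemma v11_ge0 (t : R) : 0 <= t <= 1 -> 0 <= v11 t.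
Proof. by move=> /andP[t0 t1]; rewrite /v11 mulr_ge0// subr_ge0. Qed.

Lemma V_neq0 : V != 0.
Proof.
apply/eqP => /(congr1 (horner^~ 2^-1)); rewrite hornerV horner0 /v11.
lra.
Qed.

(** Gauss exactness for the weight v11: divide f by the orthogonal polynomial;
    the quotient is too small to contribute to the integral, and the remainder
    agrees with f at the nodes and is its own interpolant. *)
Lemma gauss_quadrature (f : {poly R}) : (size f <= m + m)%N ->
  ipoly (f * V) = \sum_(k | int k) f.[x k] * ipoly (lag k * V).
Proof.
move=> sf; case: hx => _ _ _ [p [sp orth proot]].
have p0 : p != 0 by rewrite -size_poly_gt0 sp.
have fE := divp_eq f p.
have modE : f %% p = \sum_(k | int k) (f %% p).[x k] *: lag k.
  apply: (lagrange_interp lobatto_interior_inj).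
  by rewrite card_interior -ltnS -sp ltn_modp.
have -> : ipoly (f * V) = ipoly ((f %% p) * V).
  rewrite [in LHS]fE mulrDl ipolyD -[RHS]add0r; congr (_ + _).
  rewrite -(orth (f %/ p)) ?size_divp ?sp//; last by rewrite leq_subLR.
  by apply: eq_Rintegral => t _; rewrite 2!hornerM hornerV [p.[t] * _]mulrC.
rewrite [in LHS]modE mulr_suml ipoly_sum; apply: eq_bigr => k ik.
rewrite -scalerAl ipolyZ; congr (_ * _).
by rewrite [in RHS]fE hornerD hornerM (rootP (proot _ ik)) mulr0 add0r.
Qed.

(** If a node lay to one side of ]0, 1[, the polynomial (X - x_k) l_k^2 would
    have constant sign on [0, 1], although Gauss quadrature integrates it
    to 0. *)
Lemma lobatto_interior k : int k -> 0 < x k < 1.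
Proof.
move=> ik; pose f := ('X - (x k)%:P) * lag k ^+ 2.
have lagk j : int j -> (lag k).[x j] = (k == j)%:R.
  exact: (lagrange_poly_node lobatto_interior_inj).
have sl : (size (lag k) <= m)%N.
  by rewrite -[leqRHS]card_interior; exact: (size_lagrange_poly x).
have m0 : (0 < m)%N.
  by move: ik; rewrite /interior_node => /andP[k0 km]; rewrite -ltnS (leq_ltn_trans k0).
have sl2 : (size (lag k ^+ 2)%R <= (m + m).-1)%N.
  by rewrite expr2 (leq_trans (size_polyMleq _ _))// -!subn1 leq_sub2r// leq_add.
have lag0 : lag k != 0.
  by apply/eqP => l0; have := lagk k ik; rewrite l0 horner0 eqxx => /eqP; rewrite eq_sym oner_eq0.
have sf : (size f <= m + m)%N.
  rewrite (leq_trans (size_polyMleq _ _))// size_XsubC add2n/=.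
  by rewrite -[(m + m)%N]prednK ?addn_gt0 ?m0// ltnS.
have f0 : f != 0 by rewrite mulf_neq0 ?expf_neq0// polyXsubC_eq0.
have fV0 : f * V != 0 by rewrite mulf_neq0// V_neq0.
have If : ipoly (f * V) = 0.
  rewrite gauss_quadrature// big1// => j ij; rewrite hornerM horner_exp lagk//.
  rewrite hornerXsubC; have [<-|_] := eqVneq k j; first by rewrite subrr !mul0r.
  by rewrite expr0n mulr0 mul0r.
have fVE t : (f * V).[t] = (t - x k) * ((lag k).[t] ^+ 2 * v11 t).
  by rewrite hornerM hornerV hornerM horner_exp hornerXsubC -[LHS]mulrA.
rewrite !ltNge -negb_or; apply/negP => /orP[xk|xk].
  move/eqP: fV0; apply; apply: ipoly_eq0 => // t t01; rewrite fVE.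
  apply: mulr_ge0; last exact: mulr_ge0 (sqr_ge0 _) (v11_ge0 t01).
  by move: t01 => /andP[t0 _]; rewrite subr_ge0 (le_trans xk).
have : - (f * V) != 0 by rewrite oppr_eq0.
move/eqP; apply; apply: ipoly_eq0 => [t t01|]; last first.
  by rewrite -sub0r ipolyB ipoly0 If subrr.
rewrite hornerN fVE -mulNr.
apply: mulr_ge0; last exact: mulr_ge0 (sqr_ge0 _) (v11_ge0 t01).
by move: t01 => /andP[_ t1]; rewrite opprB subr_ge0 (le_trans t1).
Qed.

Lemma lobatto_weightE k : int k ->
  lobatto_weight x k = ipoly (lag k * V) / v11 (x k).
Proof.
move=> ik; rewrite /lobatto_weight ik /ipoly.
rewrite -RintegralZr//; last exact: poly_integrable01.
apply: eq_Rintegral => t _; rewrite hornerM hornerV horner_prod; congr (_ * _ / _).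
by apply: eq_bigr => j _; rewrite hornerZ hornerXsubC mulrC.
Qed.

(** Gauss quadrature of l_k^2 leaves only the k-th term, so an interior weight
    is the integral of l_k^2 v11, up to a positive factor. *)
Lemma lobatto_weight_ge0 k : 0 <= lobatto_weight x k.
Proof.
have [ik|/negbTE ik] := boolP (int k); last first.
  by rewrite /lobatto_weight ik invr_ge0 mulr_ge0.
have lagk j : int j -> (lag k).[x j] = (k == j)%:R.
  exact: (lagrange_poly_node lobatto_interior_inj).
have sl : (size (lag k) <= m)%N.
  by rewrite -[leqRHS]card_interior; exact: (size_lagrange_poly x).
rewrite lobatto_weightE// divr_ge0 ?v11_ge0//; last first.
  by have /andP[/ltW -> /ltW ->] := lobatto_interior ik.
have := @gauss_quadrature (lag k ^+ 2).
rewrite (bigD1 k)//= big1 ?addr0; last first.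
  move=> j /andP[ij jk]; rewrite horner_exp lagk// eq_sym (negbTE jk).
  by rewrite expr0n mul0r.
rewrite horner_exp lagk// eqxx expr1n mul1r => <-.
  apply: ipoly_ge0 => t t01; rewrite hornerM hornerV horner_exp.
  by rewrite mulr_ge0 ?sqr_ge0 ?v11_ge0.
rewrite expr2 (leq_trans (size_polyMleq _ _))// -subn1 leq_subLR.
by rewrite (leq_trans (leq_add sl sl))// leq_addl.
Qed.

(** Subtract from P the nonnegative polynomial E = (a (1 - X) + b X) w^2, with w
    the nodal polynomial and a, b chosen so that P - E vanishes at 0 and 1.
    Then P - E = f V with f within the reach of Gauss quadrature, E is invisible
    at the interior nodes, and only the integral of E >= 0 is lost.  In this
    way the interior sums are bounded without evaluating the endpoint weights
    of the exact rule. *)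
Lemma lobatto_interior_le (P : {poly R}) : (size P <= (m + m).+2)%N ->
  (forall t, 0 <= t <= 1 -> 0 <= P.[t]) ->
  \sum_(k | int k) lobatto_weight x k * P.[x k] <= ipoly P.
Proof.
move=> sP P0; pose w : {poly R} := \prod_(j | int j) ('X - (x j)%:P).
have wt t : (forall j, int j -> t != x j) -> w.[t] != 0.
  move=> tx; rewrite horner_prod; apply/prodf_neq0 => j ij.
  by rewrite hornerXsubC subr_eq0 tx.
have w0 : w.[0] != 0.
  by apply: wt => j /lobatto_interior/andP[x0 _]; rewrite lt_eqF.
have w1 : w.[1] != 0.
  by apply: wt => j /lobatto_interior/andP[_ x1]; rewrite gt_eqF.
have wx k : int k -> w.[x k] = 0.
  by move=> ik; rewrite horner_prod (bigD1 k)//= hornerXsubC subrr mul0r.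
have sw2 : (size (w ^+ 2)%R <= (m + m).+1)%N.
  rewrite expr2 (leq_trans (size_polyMleq _ _))//.
  by rewrite /w -big_enum size_prod_XsubC -cardE card_interior addSn addnS.
pose a := P.[0] / w.[0] ^+ 2; pose b := P.[1] / w.[1] ^+ 2.
have a0 : 0 <= a by rewrite divr_ge0 ?sqr_ge0 ?P0// lexx ler01.
have b0 : 0 <= b by rewrite divr_ge0 ?sqr_ge0 ?P0// lexx ler01.
pose E := (a *: (1 - 'X) + b *: 'X) * w ^+ 2.
have EE t : E.[t] = (a * (1 - t) + b * t) * w.[t] ^+ 2.
  by rewrite hornerM horner_exp hornerD !hornerZ hornerD hornerN hornerC hornerX.
have sE : (size E <= (m + m).+2)%N.
  rewrite (leq_trans (size_polyMleq _ _))//.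
  rewrite (@leq_trans (2 + (m + m).+1).-1)// -!subn1 leq_sub2r// leq_add//.
  rewrite (leq_trans (size_polyD _ _))// geq_max !(leq_trans (size_scale_leq _ _))//.
    by rewrite size_polyX.
  by rewrite (leq_trans (size_polyD _ _))// size_poly1 size_polyN size_polyX.
have [f [fE sf]] : exists f, P - E = f * V /\ (size f <= m + m)%N.
  have sD : (size (P - E)%R <= (m + m).+2)%N.
    by rewrite (leq_trans (size_polyD _ _))// size_polyN geq_max sP.
  have /factor_theorem[g gE] : root (P - E) 0.
    rewrite rootE hornerD hornerN EE subr0 mulr1 mulr0 addr0.
    by rewrite divfK ?subrr// expf_neq0.
  have /factor_theorem[h hE] : root g 1.
    have := congr1 (horner^~ 1) gE; rewrite hornerM hornerXsubC subr0 mulr1 rootE => <-.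
    rewrite hornerD hornerN EE subrr mulr0 mulr1 add0r.
    by rewrite divfK ?subrr// expf_neq0.
  exists (- h); split.
    by rewrite gE hE subr0 polyC1; ring.
  rewrite size_polyN; have [->|h0] := eqVneq h 0; first by rewrite size_poly0.
  move: sD; rewrite gE hE !size_Mmonic ?monicXsubC ?mulf_neq0 ?polyXsubC_eq0//.
  by rewrite !size_XsubC !addn2.
have -> : \sum_(k | int k) lobatto_weight x k * P.[x k] = ipoly (P - E).
  rewrite fE gauss_quadrature//; apply: eq_bigr => k ik.
  have vk : v11 (x k) != 0.
    have /andP[x0 x1] := lobatto_interior ik.
    by rewrite /v11 mulf_neq0 ?subr_eq0 ?gt_eqF.
  have -> : P.[x k] = f.[x k] * v11 (x k).
    by rewrite -hornerV -hornerM -fE hornerD hornerN EE wx// expr0n mulr0 subr0.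
  by rewrite lobatto_weightE//; field.
rewrite ipolyB gerDl oppr_le0; apply: ipoly_ge0 => t /andP[t0 t1].
by rewrite EE mulr_ge0 ?sqr_ge0// addr_ge0// mulr_ge0// subr_ge0.
Qed.

Lemma lobatto_interior_weight_sum : \sum_(k | int k) lobatto_weight x k <= 1.
Proof.
rewrite -ipoly1; apply: le_trans (@lobatto_interior_le 1 _ _).
- by apply: ler_sum => k _; rewrite hornerC mulr1.
- by rewrite size_poly1.
by move=> t _; rewrite hornerC.
Qed.

Lemma endpointP (k : 'I_m.+2) : ~~ int k -> k = ord0 \/ k = ord_max.
Proof.
rewrite /interior_node negb_and lt0n negbK -leqNgt => /orP[/eqP k0|km].
  by left; apply: val_inj.
by right; apply: val_inj => /=; apply/eqP; rewrite eqn_leq km -ltnS ltn_ord.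
Qed.

Lemma lobatto_node01 k : 0 <= x k <= 1.
Proof.
case: hx => x0 x1 _ _; have [ik|/endpointP[]->] := boolP (int k).
- by have /andP[/ltW -> /ltW ->] := lobatto_interior ik.
- by rewrite x0 lexx ler01.
by rewrite x1 ler01 lexx.
Qed.

Lemma lobatto_inj : injective x.
Proof.
case: (hx) => x0 x1 _ _.
have off k l : int k -> ~~ int l -> x k <> x l.
  move=> ik /endpointP il xkl; have /andP[] := lobatto_interior ik.
  by rewrite xkl; case: il => ->; rewrite ?x0 ?x1 ltxx.
move=> k l xkl; have [ik|nik] := boolP (int k); have [il|nil] := boolP (int l).
- exact: lobatto_interior_inj xkl.
- by have := off _ _ ik nil xkl.
- by have := off _ _ il nik (esym xkl).
move: xkl; case: (endpointP nik) => ->; case: (endpointP nil) => ->//;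
  rewrite x0 x1 => /eqP; first by rewrite eq_sym oner_eq0.
by rewrite oner_eq0.
Qed.

Lemma lobatto_sum_le (F : 'I_m.+2 -> R) (a e : R) : \sum_(k | int k) F k <= a ->
  (forall k, ~~ int k -> F k <= e) -> \sum_k F k <= a + e *+ 2.
Proof.
move=> Fa Fe; rewrite (bigID int)/= lerD// (bigD1 ord0)//= (bigD1 ord_max)/=; last first.
  by rewrite /interior_node/= ?ltnn ?andbF.
rewrite big_pred0 ?addr0 ?mulr2n ?lerD ?Fe//.
  by rewrite /interior_node/= ?ltnn ?andbF.
move=> k; have [//|nik] := boolP (int k).
by have [->|->] := endpointP nik; rewrite ?eqxx ?andbF.
Qed.

Lemma lobatto_weight_sum : \sum_k lobatto_weight x k <= 3.
Proof.
have -> : 3 = 1 + 1 *+ 2 :> R by ring.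
apply: lobatto_sum_le => [|k nik]; first exact: lobatto_interior_weight_sum.
by rewrite /lobatto_weight (negbTE nik) invf_le1 -natrM ?ltr0n// ler1n.
Qed.

End Lobatto.

(** * The rule applied to the model of the corner kernel *)

Section Resolvent.
Variable R : realType.
Local Notation mu := (@lebesgue_measure R).

Lemma continuous_sqr_resolvent (s : R) : 0 < s ->
  {within `[0, 1], continuous (fun t : R => ((t + s) ^+ 2)^-1)}.
Proof.
move=> s0; apply: continuous_in_subspaceT => t; rewrite inE/= in_itv/= => /andP[t0 _].
apply: (@continuousV R R (fun t : R => (t + s) ^+ 2)); first by rewrite expf_neq0// gt_eqF// ltr_wpDl.
have -> : (fun t : R => (t + s) ^+ 2) = horner (('X + s%:P) ^+ 2).
  by apply/funext => u; rewrite horner_exp hornerD hornerX hornerC.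
exact: continuous_horner.
Qed.

Lemma integral_sqr_resolvent (s : R) : 0 < s ->
  \int[mu]_(t in `[0, 1]) ((t + s) ^+ 2)^-1 = s^-1 - (1 + s)^-1.
Proof.
move=> s0; have dF (t : R) : 0 <= t ->
    is_derive t 1 (fun t => - (t + s)^-1) ((t + s) ^+ 2)^-1.
  move=> t0; have ts0 : t + s != 0 by rewrite gt_eqF// ltr_wpDl.
  have := is_deriveN (@is_deriveV R (fun u => u + s) t 1 1 ts0 _).
  rewrite scaleNr opprK [_ *: 1]mulr1; apply.
  by apply: is_derive_eq; rewrite addr0.
have cF (t : R) : 0 <= t -> {for t, continuous (fun t => - (t + s)^-1)}.
  by move=> /dF [d _]; apply: differentiable_continuous; apply/derivable1_diffP.
rewrite /Rintegral (@continuous_FTC2 _ _ (fun t => - (t + s)^-1)) ?ltr01//=.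
- by rewrite opprK add0r addrC.
- exact: continuous_sqr_resolvent.
- split.
  + by move=> t; rewrite in_itv/= => /andP[/ltW /dF [d _] _].
  + by apply: cvg_at_right_filter; exact: cF.
  + by apply: cvg_at_left_filter; exact: cF.
by move=> t; rewrite in_itv/= => /andP[/ltW /dF [_ d] _]; rewrite derive1E.
Qed.

(** The quadrature sums of s / (t + s)^2 stay bounded down to s of order m^-2.
    With Q the approximation of 1 / (t + s) of size at most m, s Q^2 is a
    polynomial within the degree of the rule, comparable to s / (t + s)^2 from
    both sides; its sum is therefore at most its integral, which is controlled
    by that of s / (t + s)^2, at most 1. *)
Lemma lobatto_interior_resolvent_sum (c s : R) (m : nat) (x : 'I_m.+2 -> R) :
  lobatto_nodes x -> 0 < c -> 0 < s -> c <= m%:R ^+ 2 * s ->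
  \sum_(k | interior_node k) lobatto_weight x k * (s / (x k + s) ^+ 2) <=
  ((1 + c) / c) ^+ 2.
Proof.
move=> hx c0 s0 ms; have [Q [sQ QE]] := @resolvent_approx R m s s0.
set rho := _^-1 in QE.
have d0 : 1 + 2 * c <= 1 + 2 * m%:R ^+ 2 * s by lra.
have rhole : rho <= (1 + 2 * c)^-1.
  by rewrite lef_pV2 ?posrE//; lra.
have rho0 : 0 <= rho by rewrite invr_ge0; lra.
have c1 : 1 - (1 + 2 * c)^-1 = 2 * c / (1 + 2 * c) by field; lra.
have c2 : 1 + (1 + 2 * c)^-1 = 2 * (1 + c) / (1 + 2 * c) by field; lra.
(* the relative error of Q is at most e, uniformly in m and s *)
set e := (1 + 2 * c)^-1 in rhole c1 c2.
have e1 : 0 < 1 - e by rewrite c1 divr_gt0//; lra.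
have Qlo t : 0 <= t <= 1 -> (1 - e) ^+ 2 * (s / (t + s) ^+ 2) <= (s *: Q ^+ 2).[t].
  move=> t01; have := QE t t01; rewrite ler_distl => /andP[].
  have ts : 0 < t + s by case/andP: t01 => t0 _; rewrite ltr_wpDl.
  move=> lo hi; rewrite hornerZ horner_exp mulrCA ler_pM2l// ler_pdivrMr ?exprn_gt0//.
  rewrite -exprMn ler_sqr ?nnegrE; lra.
have Qhi t : 0 <= t <= 1 -> (s *: Q ^+ 2).[t] <= (1 + e) ^+ 2 * s * ((t + s) ^+ 2)^-1.
  move=> t01; have := QE t t01; rewrite ler_distl => /andP[].
  have ts : 0 < t + s by case/andP: t01 => t0 _; rewrite ltr_wpDl.
  move=> lo hi; rewrite hornerZ horner_exp mulrAC mulrC ler_pM2r// ler_pdivlMr ?exprn_gt0//.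
  rewrite -exprMn ler_sqr ?nnegrE; lra.
have le1 : \sum_(k | interior_node k) lobatto_weight x k * (s / (x k + s) ^+ 2) <=
    ((1 - e) ^+ 2)^-1 * ipoly (s *: Q ^+ 2).
  rewrite mulrC ler_pdivlMr ?exprn_gt0// mulr_suml.
  apply: le_trans (lobatto_interior_le hx _ _).
  - apply: ler_sum => k ik; rewrite -mulrA ler_wpM2l ?lobatto_weight_ge0//.
    rewrite mulrC Qlo//.
    by have /andP[/ltW -> /ltW ->] := lobatto_interior hx ik.
  - rewrite (leq_trans (size_scale_leq _ _))// expr2.
    rewrite (leq_trans (size_polyMleq _ _))// -subn1 leq_subLR.
    by rewrite (leq_trans (leq_add sQ sQ))// -addn2 addnC -addnA leq_addr.
  - by move=> t _; rewrite hornerZ horner_exp mulr_ge0 ?sqr_ge0// ltW.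
have le2 : ipoly (s *: Q ^+ 2) <= (1 + e) ^+ 2.
  apply: (@le_trans _ _ (\int[mu]_(t in `[0, 1]) ((1 + e) ^+ 2 * s * ((t + s) ^+ 2)^-1))).
    apply: le_Rintegral => //.
    - exact: poly_integrable01.
    - apply: continuous_integrable01 => t; apply: cvgM; first exact: cvg_cst.
      exact: continuous_sqr_resolvent.
  have ires := continuous_integrable01 (continuous_sqr_resolvent s0).
  rewrite (RintegralZl _ _ ires)//.
  rewrite integral_sqr_resolvent// -mulrA ler_piMr ?sqr_ge0//.
  by rewrite mulrBr mulfV ?gt_eqF// gerBl mulr_ge0 ?invr_ge0 ?addr_ge0// ltW.
apply: (le_trans le1); apply: (@le_trans _ _ (((1 - e) ^+ 2)^-1 * (1 + e) ^+ 2)).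
  by rewrite ler_wpM2l// invr_ge0 sqr_ge0.
rewrite le_eqVlt; apply/orP; left; apply/eqP.
rewrite c1 c2 mulrC -expr_div_n; congr (_ ^+ 2); field.
by rewrite (gt_eqF c0)/= invr_eq0 gt_eqF// ltr_wpDr// mulr_ge0// ltW.
Qed.

(** At an endpoint the weight is at most m^-2 and the function at most 1 / s. *)
Lemma lobatto_resolvent_sum (c s : R) (m : nat) (x : 'I_m.+2 -> R) :
  lobatto_nodes x -> (0 < m)%N -> 0 < c -> 0 < s -> c <= m%:R ^+ 2 * s ->
  \sum_k lobatto_weight x k * (s / (x k + s) ^+ 2) <=
  ((1 + c) / c) ^+ 2 + c^-1 *+ 2.
Proof.
move=> hx m0 c0 s0 ms; apply: lobatto_sum_le => [|k nik].
  exact: lobatto_interior_resolvent_sum.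
have /andP[xk _] := lobatto_node01 hx k.
rewrite /lobatto_weight (negbTE nik).
apply: (@le_trans _ _ ((m%:R ^+ 2)^-1 * s^-1)); last first.
  by rewrite -invfM lef_pV2 ?posrE ?mulr_gt0 ?exprn_gt0 ?ltr0n.
apply: ler_pM.
- by rewrite invr_ge0 mulr_ge0.
- by rewrite divr_ge0 ?sqr_ge0// ltW.
- rewrite lef_pV2 ?posrE ?mulr_gt0 ?exprn_gt0 ?ltr0n//.
  by rewrite expr2 ler_pM// ler_nat// ltnW.
rewrite ler_pdivrMr ?exprn_gt0 ?ltr_wpDl// mulrC ler_pdivlMr//.
by rewrite -expr2 ler_sqr ?nnegrE ?addr_ge0 ?(ltW s0)// ler_wpDl.
Qed.

End Resolvent.

(** * Uniform bound for the discretized operators *)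

Lemma abs_cos_lt1 (R : realType) (chi : R) : -1 < chi < 1 -> chi != 0 ->
  `|cos (chi * pi)| < 1.
Proof.
move=> /andP[c1 c2] c0; have pi0 := pi_gt0 R.
have s0 : sin (chi * pi) != 0.
  move: c0; rewrite neq_lt => /orP[cn|cp].
    rewrite -[chi * pi]opprK sinN oppr_eq0 gt_eqF// sin_gt0_pi//.
    by rewrite -mulNr; apply/andP; split; nra.
  by rewrite gt_eqF// sin_gt0_pi//; apply/andP; split; nra.
have := cos2Dsin2 (chi * pi).
have : 0 < sin (chi * pi) ^+ 2 by rewrite exprn_even_gt0.
move=> ss e; have : cos (chi * pi) ^+ 2 < 1 by lra.
by rewrite -real_normK ?num_real// expr_lt1.
Qed.

(** The quadratic form s^2 + 2 t s C + t^2 is positive definite as |C| < 1, with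
    least eigenvalue 1 - |C|, and s^2 + t^2 >= (t + s)^2 / 2. *)
Lemma kernelL_le (R : realType) (chi : R) : -1 < chi < 1 -> chi != 0 ->
  exists2 b : R, 0 <= b & forall t s : R, 0 <= t -> 0 < s ->
    `|kernelL chi t s| <= b * (s / (t + s) ^+ 2).
Proof.
move=> chi1 chi0; have := abs_cos_lt1 chi1 chi0; set C := cos _ => C1.
exists (2 / (1 - `|C|)); first by rewrite divr_ge0// subr_ge0 ltW.
move=> t s t0 s0; rewrite /kernelL -/C.
have CN : - `|C| <= C by rewrite lerNl -normrN ler_norm.
have ts0 : 0 < t + s by rewrite ltr_wpDl.
have ts : 0 <= t * s by rewrite mulr_ge0// ltW.
have den : (1 - `|C|) / 2 * (t + s) ^+ 2 <= s ^+ 2 + 2 * t * s * C + t ^+ 2.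
  have h : - `|C| * (t * s) <= C * (t * s) by rewrite ler_wpM2r.
  have := normr_ge0 C; have := sqr_ge0 (t - s); nra.
have d0 : 0 < (1 - `|C|) / 2 * (t + s) ^+ 2.
  by rewrite mulr_gt0 ?exprn_gt0// divr_gt0// subr_gt0.
rewrite normrM normrN normfV normrM (gtr0_norm s0).
rewrite [`|s ^+ 2 + _ + _|]gtr0_norm ?(lt_le_trans d0)//.
rewrite (@le_trans _ _ (s * 1 / ((1 - `|C|) / 2 * (t + s) ^+ 2)))//.
  apply: ler_pM; rewrite ?mulr_ge0 ?(ltW s0)//.
  - by rewrite invr_ge0 ltW// (lt_le_trans d0).
  - by rewrite ler_wpM2l ?(ltW s0)// ler_norml sin_geN1 sin_le1.
  by rewrite lef_pV2 ?posrE// (lt_le_trans d0).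
rewrite le_eqVlt; apply/orP; left; apply/eqP; field.
by rewrite gt_eqF//= subr_eq0 gt_eqF.
Qed.

Section NormX.
Variable R : realType.

Lemma continuous_compact_bounded (T : topologicalType) (K : set T) (f : T -> R) :
  compact K -> {within K, continuous f} ->
  exists2 M, 0 <= M & forall t, K t -> `|f t| <= M.
Proof.
move=> cK cf; have [M [_ hM]] := compact_bounded (continuous_compact cf cK).
exists (`|M| + 1); first by rewrite addr_ge0.
move=> t Kt; apply: hM; last by exists t.
by rewrite (le_lt_trans (ler_norm M))// ltrDl ltr01.
Qed.

Lemma normX_ge0 (f : 'I_3 -> R -> R) : 0 <= normX f.
Proof. exact: bigmax_ge_id. Qed.

Lemma normX_ub (f : 'I_3 -> R -> R) i s : spaceX f -> 0 <= s <= 1 ->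
  `|f i s| <= normX f.
Proof.
move=> [cf _] s01; apply: le_trans (le_bigmax _ _ i).
apply: ub_le_sup; last by exists s => //=; rewrite in_itv.
have [M _ hM] := continuous_compact_bounded (@segment_compact R 0 1) (cf i).
by exists M => _ [t t01 <-]; exact: hM.
Qed.

Lemma normX_le (f : 'I_3 -> R -> R) (C : R) : 0 <= C ->
  (forall i s, 0 <= s <= 1 -> `|f i s| <= C) -> normX f <= C.
Proof.
move=> C0 fC; apply: bigmax_le => // i _; apply: ge_sup.
  by exists `|f i 0|, 0 => //=; rewrite in_itv/= lexx ler01.
by move=> _ [t t01 <-]; apply: fC; move: t01; rewrite /= in_itv.
Qed.

End NormX.

Lemma quad_op_le (R : realType) (m : nat) (x : 'I_m.+2 -> R)
    (k : R -> R -> R) (rho : R -> R) (s B : R) : lobatto_nodes x ->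
  (forall h, `|rho (x h)| <= 1) ->
  \sum_h lobatto_weight x h * `|k (x h) s| <= B -> `|quad_op x k rho s| <= B.
Proof.
move=> hx r1; apply: le_trans; apply: le_trans (ler_norm_sum _ _ _) _.
apply: ler_sum => h _; rewrite !normrM (ger0_norm (lobatto_weight_ge0 hx h)).
by rewrite ler_piMr// mulr_ge0// lobatto_weight_ge0.
Qed.

(** The threshold c / m^(2 - 2 eps) is no smaller than c / m^2. *)
Lemma threshold_ge (R : realType) (c eps : R) (m : nat) : 0 < c -> 0 < eps ->
  (0 < m)%N -> 0 < threshold c eps m /\ c <= m%:R ^+ 2 * threshold c eps m.
Proof.
move=> c0 e0 m0; have m1 : 1 <= m%:R :> R by rewrite ler1n.
have mp : 0 < m%:R `^ (2 - 2 * eps) by rewrite powR_gt0// ltr0n.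
rewrite /threshold; split; first by rewrite divr_gt0.
rewrite mulrCA ler_peMr ?(ltW c0)// ler_pdivlMr// mul1r.
by rewrite -powR_mulrn ?ler0n// ler_powR//; lra.
Qed.

Lemma kernelL0 (R : realType) (chi t : R) : kernelL chi t 0 = 0.
Proof. by rewrite /kernelL mul0r oppr0 mul0r. Qed.

Lemma opW_at0 (R : realType) (chi : R) (f : 'I_3 -> R -> R) i :
  opW chi f i 0 = if i == i3 then 0 else - (chi * pi) * f i 0.
Proof.
have iL rho : int_op (kernelL chi) rho 0 = 0.
  rewrite /int_op (@eq_Rintegral _ _ _ _ _ (cst 0)).
    by rewrite Rintegral_cst// mul0r.
  by move=> t _; rewrite kernelL0 mul0r.
have E : - pi + (1 - chi) * pi = - (chi * pi) by ring.
rewrite /opW /block_W /Omega_bar eqxx !iL E addr0 add0r.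
case: (eqVneq i i1) => [->|n1]; first by [].
by case: (eqVneq i i2) => [->|n2]; last by case: i n1 n2 => -[|[|[|//]]].
Qed.

(** The continuous kernels are bounded and the weights sum to at most 3, so only
    W_m matters.  At s at least the threshold, its diagonal part vanishes and
    the quadrature sums of L are those of [lobatto_resolvent_sum]; below the
    threshold the modified operator interpolates between the value at the
    threshold and W at 0, where L(t, 0) = 0 leaves a multiple of f(0). *)
Lemma opTm_bound (R : realType) (chi c eps : R)
    (kap : 'I_3 -> 'I_3 -> R -> R -> R) :
  -1 < chi < 1 -> chi != 0 -> 0 < c -> 0 < eps ->
  (forall i j, {within `[0, 1] `*` `[0, 1],
     continuous (fun p : R * R => kap i j p.1 p.2)}) ->
  exists2 C : R, 0 <= C & forall (m : nat) (x : 'I_m.+2 -> R) f,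
    (0 < m)%N -> lobatto_nodes x ->
    (forall i s, 0 <= s <= 1 -> `|f i s| <= 1) ->
    forall i s, 0 <= s <= 1 -> `|opTm chi c eps kap x f i s| <= C.
Proof.
move=> chi1 chi0 c0 eps0 ckap.
have [b b0 hb] := kernelL_le chi1 chi0.
have /choice[M hM] (ij : 'I_3 * 'I_3) : exists M : R, 0 <= M /\
    forall t s, 0 <= t <= 1 -> 0 <= s <= 1 -> `|kap ij.1 ij.2 t s| <= M.
  have [M M0 hM] := continuous_compact_bounded
    (compact_setX (@segment_compact R 0 1) (@segment_compact R 0 1))
    (ckap ij.1 ij.2).
  exists M; split=> // t s t01 s01; apply: (hM (t, s)).
  by split; rewrite /= in_itv.
pose BL := b * (((1 + c) / c) ^+ 2 + c^-1 *+ 2).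
have pi0 := pi_ge0 R.
have BL0 : 0 <= BL by rewrite mulr_ge0// addr_ge0 ?sqr_ge0// mulrn_wge0// invr_ge0 ltW.
have S0 : 0 <= \sum_i \sum_j M (i, j) * 3.
  by apply: sumr_ge0 => i _; apply: sumr_ge0 => j _; rewrite mulr_ge0//;
    case: (hM (i, j)).
(* the terms bound - pi f, the modified W_m, and S_m *)
exists (pi + (BL + pi) + \sum_i \sum_j M (i, j) * 3); first lra.
move=> m x f m0 hx f1 i s s01.
have fx j h : `|f j (x h)| <= 1 by apply: f1; exact: lobatto_node01.
have [h0 mh] := threshold_ge c0 eps0 m0.
have Wm_le j u : threshold c eps m <= u -> `|opWm chi x f j u| <= BL.
  move=> hu; have u0 : 0 < u by exact: lt_le_trans hu.
  have LB l : `|quad_op x (kernelL chi) (f l) u| <= BL.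
    apply: quad_op_le => //; apply: (@le_trans _ _
      (b * \sum_k lobatto_weight x k * (u / (x k + u) ^+ 2))).
      rewrite mulr_sumr; apply: ler_sum => k _; rewrite mulrCA.
      rewrite ler_wpM2l ?lobatto_weight_ge0// hb//.
      by have /andP[] := lobatto_node01 hx k.
    rewrite ler_wpM2l// lobatto_resolvent_sum//.
    by rewrite (le_trans mh)// ler_wpM2l ?exprn_ge0.
  rewrite /opWm /block_W /Omega_bar (gt_eqF u0) addNr !mul0r add0r addr0.
  by case: ifP => _; [|case: ifP => _; rewrite ?normr0].
have W0_le j : `|opW chi f j 0| <= pi.
  rewrite opW_at0; case: ifP => _; first by rewrite normr0.
  rewrite normrM normrN normrM (ger0_norm pi0) -[leRHS]mulr1 ler_pM//.
    by rewrite mulr_ge0.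
  - by rewrite ler_piMl// ler_norml; case/andP: chi1 => ? ?; apply/andP; split; lra.
  by apply: f1; rewrite lexx ler01.
rewrite /opTm; apply: le_trans (ler_normD _ _) _; apply: lerD; last first.
  rewrite /opSm; apply: (@le_trans _ _ (\sum_j M (i, j) * 3)).
    apply: le_trans (ler_norm_sum _ _ _) _.
    apply: ler_sum => j _; have [Mij hMij] := hM (i, j).
    apply: quad_op_le => //; apply: (@le_trans _ _ (M (i, j) * \sum_k lobatto_weight x k)).
      rewrite mulr_sumr; apply: ler_sum => k _; rewrite mulrC.
      by rewrite ler_wpM2r ?lobatto_weight_ge0// hMij// lobatto_node01.
    by rewrite ler_wpM2l// lobatto_weight_sum.
  rewrite [leRHS](bigD1 i)//= lerDl.
  by apply: sumr_ge0 => k _; apply: sumr_ge0 => j _; rewrite mulr_ge0//;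
    case: (hM (k, j)).
apply: le_trans (ler_normD _ _) _; apply: lerD.
  by rewrite normrM normrN (ger0_norm pi0) ler_piMr// f1.
rewrite /opWtilde; case: ifPn => [hs|].
  by rewrite (le_trans (Wm_le _ _ hs))// lerDl.
rewrite -ltNge => sh; set h := threshold _ _ _ in h0 sh *.
rewrite normrM normfV (gtr0_norm h0) mulrC ler_pdivrMr//.
have /andP[s0 s1] := s01.
have := Wm_le i h (lexx _); have := W0_le i.
move: (opWm _ _ _ _ _) (opW _ _ _ _) => u v hv hu.
apply: le_trans (ler_normD _ _) _; rewrite !normrM (ger0_norm s0).
by rewrite [`|h - s|]gtr0_norm ?subr_gt0//; nra.
Qed.

(** * From the operator to the collocation matrix *)

Section Collocation.
Variables (R : realType) (m : nat) (x : 'I_m.+2 -> R).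
Hypotheses (injx : injective x) (x01 : forall l, 0 <= x l <= 1) (x0 : x ord0 = 0).

Local Notation normcV := (fun a : 'cV[R]_(3 * m.+2) => `|a|).

Definition sample (f : 'I_3 -> R -> R) : 'cV[R]_(3 * m.+2) :=
  (mxvec (\matrix_(i, l) f i (x l)))^T.

Lemma sampleE f i l : sample f (mxvec_index i l) 0 = f i (x l).
Proof. by rewrite mxE mxvecE mxE. Qed.

Lemma eq_mxvec_index (a b : 'cV[R]_(3 * m.+2)) :
  (forall i l, a (mxvec_index i l) 0 = b (mxvec_index i l) 0) -> a = b.
Proof. by move=> ab; apply/colP => k; case/mxvec_indexP: k. Qed.

Lemma Rtilde_sample f : spaceX f -> Rtilde (sample f).
Proof. by move=> [_ f0]; rewrite /Rtilde/= !sampleE x0. Qed.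

Lemma normcV_ub (a : 'cV[R]_(3 * m.+2)) k : `|a k 0| <= `|a|.
Proof.
by rewrite [`|a|]mx_normrE; exact: (le_bigmax _ (fun ij => `|a ij.1 ij.2|) (k, 0)).
Qed.

Lemma norm_sample f : spaceX f -> `|sample f| <= normX f.
Proof.
move=> Xf; rewrite [`|sample f|]mx_normrE; apply: bigmax_le => [|[k j] _].
  exact: normX_ge0.
by case/mxvec_indexP: k => i l; rewrite /= ord1 sampleE normX_ub.
Qed.

(** The Lagrange interpolant of the entries, clipped at the norm of the vector:
    clipping keeps continuity and does not change the values at the nodes. *)
Lemma sample_onto a : Rtilde a ->
  exists f, [/\ spaceX f, sample f = a & normX f <= `|a|].
Proof.
move=> Ra; pose N := `|a|.
pose p i := \sum_(l | predT l) a (mxvec_index i l) 0 *: lagrange_poly predT x l.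
have px i l : (p i).[x l] = a (mxvec_index i l) 0.
  rewrite horner_sum (bigD1 l)//= big1 => [|j jl].
    by rewrite hornerZ lagrange_poly_node ?eqxx ?mulr1 ?addr0// => ? ? _ _ /injx.
  rewrite hornerZ lagrange_poly_node ?(negbTE jl) ?mulr0// => ? ? _ _; exact: injx.
(* min(N, p) is written - max(- N, - p) *)
pose f i s := Num.max (- N) (- Num.max (- N) (- (p i).[s])).
have fx i l : f i (x l) = a (mxvec_index i l) 0.
  rewrite /f px; set u := a _ _; have : `|u| <= N by exact: normcV_ub.
  rewrite ler_norml => /andP[Nu uN].
  by rewrite [Num.max _ (- u)]max_r ?lerN2// opprK max_r.
exists f; split.
- split; last by rewrite -x0 !fx.
  have cclip (q : R -> R) : continuous q -> continuous (fun s => - Num.max (- N) (- q s)).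
    move=> cq s; apply: (@continuousN _ _ _ ((fun=> - N) \max (fun s => - q s))).
    by apply: continuous_max; [exact: cvg_cst|apply: continuousN; exact: cq].
  move=> i; apply: continuous_subspaceT => s.
  change {for s, continuous ((fun=> - N) \max (fun s => - Num.max (- N) (- (p i).[s])))}.
  apply: continuous_max; first exact: cvg_cst.
  by apply: (cclip (horner (p i))); exact: continuous_horner.
- by apply: eq_mxvec_index => i l; rewrite sampleE.
apply: normX_le => // i s _; rewrite /f -/N ler_norml le_max lexx/=.
by rewrite ge_max ge0_cp ?normr_ge0//= lerNl le_max lexx.
Qed.

Variables (T : ('I_3 -> R -> R) -> 'I_3 -> R -> R) (A : 'M[R]_(3 * m.+2)).
Hypothesis T_nystrom : forall f f', sample f = sample f' ->
  forall i s, 0 <= s <= 1 -> T f i s + pi * f i s = T f' i s + pi * f' i s.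
Hypothesis T_inv : invertible_on (@spaceX R) (@eqX R) T.
Hypothesis A_T : collocation_matrix x T A.

Lemma sample_eqX f g : eqX f g -> sample f = sample g.
Proof.
move=> fg; apply: eq_mxvec_index => i l; rewrite !sampleE.
by apply: fg; rewrite in_itv/= x01.
Qed.

Lemma mulmx_sample f : spaceX f -> A *m sample f = sample (T f).
Proof.
move=> Xf; apply: eq_mxvec_index => i l; rewrite sampleE.
by apply: A_T => //; [exact: Rtilde_sample|move=> *; rewrite sampleE].
Qed.

(** A solution of the linear system lifts to a solution of the operator equation.
    Any interpolant f of a can be corrected by (T f - g) / pi, which vanishes at
    the nodes; T + pi does not see the correction, so T changes by exactly
    g - T f. *)
Lemma nystrom_lift a g : Rtilde a -> spaceX g -> A *m a = sample g ->
  exists f, [/\ spaceX f, sample f = a & eqX (T f) g].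
Proof.
move=> Ra Xg; have [f [Xf <- _]] := sample_onto Ra.
rewrite mulmx_sample// => Tfg; have [TX _] := T_inv.
have [cTf Tf0] := TX _ Xf; have [cf f0] := Xf; have [cg g0] := Xg.
have pi0 : pi != 0 :> R by rewrite gt_eqF// pi_gt0.
pose f' i s := f i s + pi^-1 * (T f i s - g i s).
have ff' : sample f = sample f'.
  apply: eq_mxvec_index => i l; rewrite !sampleE /f' -[T f i _]sampleE Tfg.
  by rewrite sampleE subrr mulr0 addr0.
exists f'; split=> //.
  split; last by rewrite /f' f0 g0 Tf0.
  move=> i t; apply: cvgD; first exact: cf.
  apply: cvgM; first exact: cvg_cst.
  by apply: cvgB; [exact: cTf|exact: cg].
move=> i s; rewrite in_itv/= => s01.
have := T_nystrom ff' i s01; rewrite {2}/f' mulrDr mulrA mulfV// mul1r.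
move: (T f' i s) => u h; lra.
Qed.

Lemma mulmx_Rtilde : set_fun (@Rtilde R m) (@Rtilde R m) (mulmx A).
Proof.
move=> a Ra; have [f [Xf <- _]] := sample_onto Ra.
by rewrite mulmx_sample//; apply: Rtilde_sample; apply: T_inv.1.
Qed.

(** Solutions of the linear system are the samples of solutions in X: existence
    by sampling, uniqueness by lifting. *)
Lemma collocation_invertible : invertible_on (@Rtilde R m) eq (mulmx A).
Proof.
split; first exact: mulmx_Rtilde.
move=> b Rb; have [g [Xg gb _]] := sample_onto Rb.
have [f [Xf Tfg f_uniq]] := T_inv.2 _ Xg.
exists (sample f); split; first exact: Rtilde_sample.
  by rewrite mulmx_sample// -gb; exact: sample_eqX.
move=> a' Ra' Aa'; have [f' [Xf' <- Tf'g]] := nystrom_lift Ra' Xg (etrans Aa' (esym gb)).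
by apply: sample_eqX; exact: f_uniq.
Qed.

Lemma opnorm_ge0 (V : Type) (X : set V) (N : V -> R) (S : V -> V) (v : V) :
  (forall u, 0 <= N u) -> X v -> N v <= 1 -> (0 <= opnorm X N S)%E.
Proof.
move=> N0 Xv v1; apply: (@le_trans _ _ (N (S v))%:E); first by rewrite lee_fin.
by apply: ereal_sup_ubound; exists v.
Qed.

Lemma collocation_opnorm_le :
  (opnorm (@Rtilde R m) normcV (mulmx A) <=
   opnorm (@spaceX R) (@normX R) T)%E.
Proof.
apply: ge_ereal_sup => _ [/= a [Ra a1] <-]; have [f [Xf fa fN]] := sample_onto Ra.
apply: (@le_trans _ _ (normX (T f))%:E).
  by rewrite lee_fin -fa mulmx_sample// norm_sample//; exact: T_inv.1.
apply: ereal_sup_ubound; exists f => //; split => //.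
exact: le_trans a1.
Qed.

Lemma collocation_inverse_opnorm_le :
  (opnorm (@Rtilde R m) normcV
     (inverse_on (@Rtilde R m) eq (mulmx A)) <=
   opnorm (@spaceX R) (@normX R) (inverse_on (@spaceX R) (@eqX R) T))%E.
Proof.
apply: ge_ereal_sup => _ [b [Rb b1] <-]; have [g [Xg gb gN]] := sample_onto Rb.
set f := inverse_on (@spaceX R) (@eqX R) T g.
have [Xf Tfg] : spaceX f /\ eqX (T f) g.
  by apply: (@getPex _ [set f | spaceX f /\ eqX (T f) g]);
    have [h [Xh Thg _]] := T_inv.2 _ Xg; exists h.
have [a [Ra Aa a_uniq]] := collocation_invertible.2 _ Rb.
have [Ra' Aa'] := @getPex _ [set a | Rtilde a /\ A *m a = b] (ex_intro _ a (conj Ra Aa)).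
rewrite -/(inverse_on _ _ _ _) in Ra' Aa'.
have -> : inverse_on (@Rtilde R m) eq (mulmx A) b = sample f.
  rewrite (a_uniq _ Ra' Aa'); apply/esym/a_uniq; first exact: Rtilde_sample.
  by rewrite mulmx_sample// -gb; exact: sample_eqX.
apply: (@le_trans _ _ (normX f)%:E); first by rewrite lee_fin norm_sample.
by apply: ereal_sup_ubound; exists g => //; split => //; exact: le_trans b1.
Qed.

Lemma spaceX0 : @spaceX R (fun _ _ => 0).
Proof. by split=> // i; apply: continuous_subspaceT => s; exact: cvg_cst. Qed.

Lemma normX0_le1 : normX (fun _ _ => 0 : R) <= 1.
Proof. by apply: normX_le => // i s _; rewrite normr0. Qed.

Lemma opnormX_ge0 S : (0 <= opnorm (@spaceX R) (@normX R) S)%E.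
Proof. exact: opnorm_ge0 (@normX_ge0 R) spaceX0 normX0_le1. Qed.

Lemma condA_le_condX : (condA A <= condX T)%E.
Proof.
have R0 : @Rtilde R m 0 by rewrite /Rtilde/= !mxE.
have A0 S : (0 <= opnorm (@Rtilde R m) normcV S)%E.
  by apply: (opnorm_ge0 _ _ R0); rewrite ?normr0.
apply: lee_pmul => //; first exact: collocation_opnorm_le.
exact: collocation_inverse_opnorm_le.
Qed.

End Collocation.

(** At s = 0 the diagonal terms of W involve f at 0, which is itself a node; at
    s > 0 they cancel. *)
Lemma opTm_nystrom (R : realType) (chi c eps : R)
    (kap : 'I_3 -> 'I_3 -> R -> R -> R) (m : nat) (x : 'I_m.+2 -> R) f f' :
  0 < threshold c eps m -> x ord0 = 0 -> sample x f = sample x f' ->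
  forall i s, opTm chi c eps kap x f i s + pi * f i s =
              opTm chi c eps kap x f' i s + pi * f' i s.
Proof.
move=> h0 x0 ff' i s.
have fx j l : f j (x l) = f' j (x l) by rewrite -!sampleE ff'.
have qE k j u : quad_op x k (f j) u = quad_op x k (f' j) u.
  by apply: eq_bigr => l _; rewrite fx.
have WE u : 0 < u -> opWm chi x f i u = opWm chi x f' i u.
  by move=> u0; rewrite /opWm /block_W /Omega_bar (gt_eqF u0) addNr !mul0r !qE.
have SE : opSm kap x f i s = opSm kap x f' i s.
  by apply: eq_bigr => j _; rewrite qE.
have W0E : opW chi f i 0 = opW chi f' i 0 by rewrite !opW_at0 -x0 fx.
have WtE : opWtilde chi c eps x f i s = opWtilde chi c eps x f' i s.
  rewrite /opWtilde; case: ifP => hs; first by rewrite WE// (lt_le_trans h0).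
  by rewrite WE// W0E.
by rewrite /opTm WtE SE; ring.
Qed.

Theorem theorem3p5 (R : realType) (chi delta : R) (D : set (R * R))
    (xi eta : 'I_3 -> R -> R) (kap : 'I_3 -> 'I_3 -> R -> R -> R)
    (c eps : R) (x : forall m : nat, 'I_m.+2 -> R)
    (A : forall m : nat, 'M[R]_(3 * m.+2)) (m0 : nat)
    (hD : corner_domain chi delta D xi eta)
    (hC2 : forall P, (Sigma xi eta `\ (xi i1 0, eta i1 0)) P ->
       C2_curve_at (Sigma xi eta) P)
    (hkap : continuous_extension chi xi eta kap)
    (hc : 0 < c) (heps : 0 < eps)
    (hx : forall m, (0 < m)%N -> lobatto_nodes (x m))
    (hker : forall f, spaceX f -> eqX (opT chi kap f) (fun _ _ => 0) ->
       eqX f (fun _ _ => 0))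
    (hm0 : (0 < m0)%N)
    (hthr : forall m, (m0 <= m)%N -> threshold c eps m <= 1)
    (hinv : forall m, (m0 <= m)%N ->
       invertible_on (@spaceX R) (@eqX R) (opTm chi c eps kap (x m)))
    (hbnd : exists B : R, forall m, (m0 <= m)%N ->
       (opnorm (@spaceX R) (@normX R)
         (inverse_on (@spaceX R) (@eqX R) (opTm chi c eps kap (x m)))
        <= B%:E)%E)
    (hA : forall m, (m0 <= m)%N ->
       collocation_matrix (x m) (opTm chi c eps kap (x m)) (A m)) :
  exists C : R, 0 < C /\ forall m, (m0 <= m)%N ->
    [/\ invertible_on (@Rtilde R m) eq (mulmx (A m)),
        (condA (A m) <= condX (opTm chi c eps kap (x m)))%E &
        (condX (opTm chi c eps kap (x m)) <= C%:E)%E].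
Proof.
have [C C0 hC] := opTm_bound (cd_chi hD) (cd_chi0 hD) hc heps
  (fun i j => (hkap i j).1).
have [B hB] := hbnd.
have B0 : 0 <= B by rewrite -lee_fin; apply: le_trans (hB m0 (leqnn _)); exact: opnormX_ge0.
exists (C * B + 1); split; first by rewrite ltr_wpDl// mulr_ge0.
move=> m m0m; have mgt0 : (0 < m)%N by exact: leq_trans m0m.
have hxm := hx m mgt0; have [h0 _] := threshold_ge hc heps mgt0.
have [x0 _ _ _] := hxm.
have ny f f' : sample (x m) f = sample (x m) f' -> forall i s, 0 <= s <= 1 ->
    opTm chi c eps kap (x m) f i s + pi * f i s =
    opTm chi c eps kap (x m) f' i s + pi * f' i s.
  by move=> ff' i s _; exact: opTm_nystrom.
have inj := lobatto_inj hxm; have x01 := lobatto_node01 hxm.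
split.
- exact: (collocation_invertible inj x01 x0 ny (hinv m m0m) (hA m m0m)).
- exact: (condA_le_condX inj x01 x0 ny (hinv m m0m) (hA m m0m)).
apply: (@le_trans _ _ (C%:E * B%:E)%E); last by rewrite -EFinM lee_fin lerDl.
apply: lee_pmul; rewrite ?opnormX_ge0 ?hB//.
apply: ge_ereal_sup => _ [f [Xf f1] <-]; rewrite lee_fin.
apply: normX_le => // i s s01; apply: hC => // j t t01.
exact: le_trans (normX_ub j Xf t01) f1.
Qed.
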